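(* Let $N(x)$ be a formula, obtained by the usual shortening of cuts, such that $\mathrm{PA}^-$ proves that $N$ is a cut closed under $+$ and $\cdot$, and $\mathrm{PA}^-$ proves $N(x)\to I_3(x)$. Then $\mathrm{PA}^-$ is a sequential theory with respect to $N$ and $\beta'$.
   Context: $\mathrm{PA}^-$ is the first-order theory with equality in the language $\langle 0,1,+,\cdot,\le\rangle$ axiomatized by (the universal closures of): $x+0=x$; $x+y=y+x$; $(x+y)+z=x+(y+z)$; $x\cdot1=x$; $x\cdot y=y\cdot x$; $(x\cdot y)\cdot z=x\cdot(y\cdot z)$; $x\cdot(y+z)=x\cdot y+x\cdot z$; $x\le y\lor y\le x$; $(x\le y\land y\le z)\to x\le z$; $\neg(x+1\le x)$; $x\le y\to(x=y\lor x+1\le y)$; $x\le y\to x+z\le y+z$; $x\le y\to x\cdot z\le y\cdot z$. (No subtraction axiom is included.) $x<y$ abbreviates $x\le y\land x\ne y$. A theory $T$ is sequential (with respect to formulas $N(x)$ and $\beta(x,i,w)$) if $T$ contains Robinson's arithmetic $Q$ relativized to $N(x)$ (here with successor $x\mapsto x+1$), and $T$ proves $\forall w,x,k\,\exists w'\,\forall i,y\,[(N(k)\land i\le k)\to(\beta(y,i,w')\leftrightarrow((i<k\land\beta(y,i,w))\lor(i=k\land y=x)))]$. In the claim, $\beta'$ defined below plays the role of $\beta$ in this definition. A definable set is inductive if it contains $0$ and is closed under successor $x\mapsto x+1$; it is a cut if it is furthermore downward closed. Notation: $\langle x,y\rangle:=(x+y)^2+x$. Gödel's $\beta$-function is $\beta(x,i,w):\leftrightarrow\exists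 u,v,q\,[w=\langle u,v\rangle\land u=q(1+(i+1)v)+x\land x\le(i+1)v]$. The modified function is $$\beta'(x,i,w):\leftrightarrow[\beta(x,i,w)\land\forall j<i\,\exists y\,\beta(y,j,w)]\lor[x=0\land\exists j\le i\,\neg\exists y\,\beta(y,j,w)].$$ $y\mid x$ denotes $\exists q\,(x=qy)$, and $x\,\mathrm{rem}\,y=z$ denotes $z<y\land\exists q\,(x=z+qy)$ (provably a partial function). Formulas: $I_0(k):\leftrightarrow\forall j\le i\le k\,\exists d\,(d+j=i)$ (with $i$ and $j$ both universally quantified). $I_1(k):\leftrightarrow I_0(k)\land\forall v\,\exists u\,\bigl[\forall i\le k\,((1+iv)\mid u)\land\forall i>k\,\bigl((I_0(i)\land\forall j\,(0<j\le k\to(i-j)\mid v))\to\exists p\,(up\,\mathrm{rem}\,(1+iv)=1)\bigr)\bigr]$, where $i-j$ denotes the unique $d$ with $d+j=i$, which exists because of $I_0(i)$. $I_2(k):\leftrightarrow I_1(k)\land\forall u,v,v',x\,\exists u'\,\bigl[\bigl(\forall i\,(0<i\le k\to i\mid v')\land v'\ge v\land(k+1)v'\ge x\land\forall i\le k\,\exists r\,(r=u\,\mathrm{rem}\,(1+iv))\bigr)\to\bigl(\forall i\le k\,\exists r\,(r=u\,\mathrm{rem}\,(1+iv)\land r=u'\,\mathrm{rem}\,(1+iv'))\land x=u'\,\mathrm{rem}\,(1+(k+1)v')\bigr)\bigr]$. $I_3(k):\leftrightarrow I_2(k)\land\forall w'\,\exists w\,\forall i<k\,\forall x\,(\beta(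x,i,w)\leftrightarrow\beta'(x,i,w'))$.
   Formalization: As displayed, I_1(0) is refutable in PA^- (v=0, i=1 asks for remainder 1 modulo 1), so no such N exists; the formal theorem covers this literal reading and also the corrected one, in which ''for all v there is u'' in I_1 ranges over nonzero v and u. *)

(* Defs.v *)
From Stdlib Require Import List.
Import ListNotations.

(* De Bruijn indices; [All] binds index 0. *)
Inductive term : Type :=
| Var (n : nat)
| Zero
| One
| Add (s t : term)
| Mul (s t : term).

Inductive form : Type :=
| Bot
| Eq (s t : term)
| Le (s t : term)
| Imp (A B : form)
| All (A : form).

(* The other connectives are the usual classical abbreviations. *)
Definition Neg (A : form) : form := Imp A Bot.
Definition Or (A B : form) : form := Imp (Neg A) B.
Definition And (A B : form) : form := Neg (Imp A (Neg B)).
Definition Iff (A B : form) : form := And (Imp A B) (Imp B A).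
Definition Ex (A : form) : form := Neg (All (Neg A)).

Fixpoint subst_term (s : nat -> term) (t : term) : term :=
  match t with
  | Var n => s n
  | Zero => Zero
  | One => One
  | Add t u => Add (subst_term s t) (subst_term s u)
  | Mul t u => Mul (subst_term s t) (subst_term s u)
  end.

Definition shift (n : nat) : term := Var (S n).

Definition scons (t : term) (s : nat -> term) (n : nat) : term :=
  match n with
  | O => t
  | S n => s n
  end.

Definition up (s : nat -> term) : nat -> term :=
  scons (Var 0) (fun n => subst_term shift (s n)).

Fixpoint subst (s : nat -> term) (A : form) : form :=
  match A with
  | Bot => Bot
  | Eq t u => Eq (subst_term s t) (subst_term s u)
  | Le t u => Le (subst_term s t) (subst_term s u)
  | Imp A B => Imp (subst s A) (subst s B)
  | All A => All (subst (up s) A)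
  end.

Definition inst (A : form) (t : term) : form := subst (scons t Var) A.

Fixpoint bounded_term (n : nat) (t : term) : Prop :=
  match t with
  | Var m => m < n
  | Zero | One => True
  | Add t u | Mul t u => bounded_term n t /\ bounded_term n u
  end.

(* [bounded n A]: all free variables of [A] have index below [n]. *)
Fixpoint bounded (n : nat) (A : form) : Prop :=
  match A with
  | Bot => True
  | Eq t u | Le t u => bounded_term n t /\ bounded_term n u
  | Imp A B => bounded n A /\ bounded n B
  | All A => bounded (S n) A
  end.

(* Classical natural deduction with equality.  A theory is a set of sentences;
   hence its axioms need no lifting in [AllI]. *)
Inductive derives (T : form -> Prop) : list form -> form -> Prop :=
| Axm G A : T A -> derives T G A
| Hyp G A : In A G -> derives T G A
| ImpI G A B : derives T (A :: G) B -> derives T G (Imp A B)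
| ImpE G A B : derives T G (Imp A B) -> derives T G A -> derives T G B
| Raa G A : derives T (Neg A :: G) Bot -> derives T G A
| AllI G A : derives T (map (subst shift) G) A -> derives T G (All A)
| AllE G A t : derives T G (All A) -> derives T G (inst A t)
| EqRefl G t : derives T G (Eq t t)
| EqSubst G A s t :
    derives T G (Eq s t) -> derives T G (inst A s) -> derives T G (inst A t).

Definition provable (T : form -> Prop) (A : form) : Prop := derives T [] A.

(* A [tm] (an [fm]) is a term (a formula) given as a function of the number [d]
   of quantifiers it stands under.  The variable bound by the quantifier
   occurring under [d] others has index [d' - S d] under [d'] quantifiers, so
   the macros below need neither explicit lifting nor fresh names.  The
   formula denoted by [A : fm] is [A 0]. *)
Definition tm : Type := nat -> term.
Definition fm : Type := nat -> form.

Definition all (A : tm -> fm) : fm :=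
  fun d => All (A (fun d' => Var (d' - S d)) (S d)).
Definition ex (A : tm -> fm) : fm :=
  fun d => Ex (A (fun d' => Var (d' - S d)) (S d)).

(* The free variable of index [n]. *)
Definition free (n : nat) : tm := fun d => Var (d + n).

Declare Scope fo_scope.
Delimit Scope fo_scope with fo.
Bind Scope fo_scope with tm.
Bind Scope fo_scope with fm.

Notation "0" := (fun _ : nat => Zero) : fo_scope.
Notation "1" := (fun _ : nat => One) : fo_scope.
Notation "x + y" := (fun d : nat => Add (x%fo d) (y%fo d)) : fo_scope.
Notation "x * y" := (fun d : nat => Mul (x%fo d) (y%fo d)) : fo_scope.
Notation "x == y" := (fun d : nat => Eq (x%fo d) (y%fo d))
  (at level 70, no associativity) : fo_scope.
Notation "x <= y" := (fun d : nat => Le (x%fo d) (y%fo d)) : fo_scope.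
Notation "~ A" := (fun d : nat => Neg (A%fo d)) : fo_scope.
Notation "A /\ B" := (fun d : nat => And (A%fo d) (B%fo d)) : fo_scope.
Notation "A \/ B" := (fun d : nat => Or (A%fo d) (B%fo d)) : fo_scope.
Notation "A --> B" := (fun d : nat => Imp (A%fo d) (B%fo d))
  (at level 99, right associativity, B at level 200) : fo_scope.
Notation "A <-> B" := (fun d : nat => Iff (A%fo d) (B%fo d)) : fo_scope.
Notation "'FA' x .. y , A" := (all (fun x => .. (all (fun y => A%fo)) ..))
  (at level 200, x binder, y binder, right associativity) : fo_scope.
Notation "'EX' x .. y , A" := (ex (fun x => .. (ex (fun y => A%fo)) ..))
  (at level 200, x binder, y binder, right associativity) : fo_scope.

Definition lt (x y : tm) : fm := (x <= y /\ ~ (x == y))%fo.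
Notation "x < y" := (lt x%fo y%fo) : fo_scope.

(* [A(x)] and [A(x,y,z)] for formulas with free variables of index 0, resp.
   0, 1, 2. *)
Definition app1 (A : form) (x : tm) : fm :=
  fun d => subst (scons (x d) Var) A.
Definition app3 (A : form) (x y z : tm) : fm :=
  fun d => subst (scons (x d) (scons (y d) (scons (z d) Var))) A.

Local Open Scope fo_scope.

Definition PAminus_axioms : list fm :=
  [ FA x, x + 0 == x;
    FA x y, x + y == y + x;
    FA x y z, (x + y) + z == x + (y + z);
    FA x, x * 1 == x;
    FA x y, x * y == y * x;
    FA x y z, (x * y) * z == x * (y * z);
    FA x y z, x * (y + z) == x * y + x * z;
    FA x y, x <= y \/ y <= x;
    FA x y z, x <= y /\ y <= z --> x <= z;
    FA x, ~ (x + 1 <= x);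
    FA x y, x <= y --> x == y \/ x + 1 <= y;
    FA x y z, x <= y --> x + z <= y + z;
    FA x y z, x <= y --> x * z <= y * z ].

Definition PAminus (A : form) : Prop :=
  (exists B : fm, In B PAminus_axioms /\ A = B 0%nat)%type.

(* Robinson's arithmetic, with successor x + 1. *)
Definition Q_axioms : list fm :=
  [ FA x, ~ (x + 1 == 0);
    FA x y, x + 1 == y + 1 --> x == y;
    FA x, ~ (x == 0) --> EX y, x == y + 1;
    FA x, x + 0 == x;
    FA x y, x + (y + 1) == (x + y) + 1;
    FA x, x * 0 == 0;
    FA x y, x * (y + 1) == x * y + x;
    FA x y, x <= y <-> EX z, z + x == y ].

(* [N] has only index 0 free, so that under the binder it speaks about the
   bound variable. *)
Fixpoint relativize (N A : form) : form :=
  match A with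
  | Bot => Bot
  | Eq t u => Eq t u
  | Le t u => Le t u
  | Imp A B => Imp (relativize N A) (relativize N B)
  | All A => All (Imp N (relativize N A))
  end.

(* The domain of the relativization is closed under the operations of Q. *)
Definition closed_domain (N : form) : list fm :=
  [ app1 N 0;
    FA x, app1 N x --> app1 N (x + 1);
    FA x y, app1 N x /\ app1 N y --> app1 N (x + y);
    FA x y, app1 N x /\ app1 N y --> app1 N (x * y) ].

Definition contains_relativized_Q (T : form -> Prop) (N : form) : Prop :=
  ((forall A : fm, In A (closed_domain N) -> provable T (A 0%nat)) /\
   (forall A : fm, In A Q_axioms -> provable T (relativize N (A 0%nat))))%type.

Definition sequence_extension (N B : form) : fm :=
  FA w x k, EX w', FA i y,
    app1 N k /\ i <= k -->
    (app3 B y i w' <-> (i < k /\ app3 B y i w) \/ (i == k /\ y == x)).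

Definition sequential (T : form -> Prop) (N B : form) : Prop :=
  (bounded 1 N /\ bounded 3 B /\
   contains_relativized_Q T N /\
   provable T (sequence_extension N B 0%nat))%type.

Definition inductive (N : form) : fm :=
  app1 N 0 /\ (FA x, app1 N x --> app1 N (x + 1)).

Definition cut (N : form) : fm :=
  inductive N /\ (FA x y, app1 N y /\ x <= y --> app1 N x).

Definition closed_add_mul (N : form) : fm :=
  (FA x y, app1 N x /\ app1 N y --> app1 N (x + y)) /\
  (FA x y, app1 N x /\ app1 N y --> app1 N (x * y)).

Definition pair (x y : tm) : tm := (x + y) * (x + y) + x.

Definition beta (x i w : tm) : fm :=
  EX u v q, w == pair u v /\ u == q * (1 + (i + 1) * v) + x /\ x <= (i + 1) * v.

Definition beta' (x i w : tm) : fm :=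
  (beta x i w /\ FA j, j < i --> EX y, beta y j w) \/
  (x == 0 /\ EX j, j <= i /\ ~ EX y, beta y j w).

Definition beta'_form : form := beta' (free 0) (free 1) (free 2) 0%nat.

Definition dvd (y x : tm) : fm := EX q, x == q * y.

(* x rem y = z *)
Definition is_rem (x y z : tm) : fm := z < y /\ EX q, x == z + q * y.

Definition I0 (k : tm) : fm :=
  FA i j, j <= i /\ i <= k --> EX d, d + j == i.

(* [EX d, d + j == i /\ dvd d v] says that [i - j] divides [v]. *)
Definition I1_body (k v u : tm) : fm :=
  (FA i, i <= k --> dvd (1 + i * v) u) /\
  (FA i, k < i -->
     (I0 i /\ FA j, 0 < j /\ j <= k --> EX d, d + j == i /\ dvd d v) -->
     EX p, is_rem (u * p) (1 + i * v) 1).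

(* In I_1 the quantifier prefix "for all v there is u" can be read over all
   numbers ([Verbatim]) or over the nonzero ones ([Nonzero]).  Read over all
   numbers, I_1(0) is refutable in PA^-: for v = 0, i = 1 it asks for a number
   with remainder 1 modulo 1.  Excluding only v = 0 would still allow u = 0
   whenever no i satisfies the premise of the coprimality clause, and then I_1
   does not provide a nonzero common multiple of 1, ..., k. *)
Inductive reading : Set := Verbatim | Nonzero.

Definition I1 (rd : reading) (k : tm) : fm :=
  match rd with
  | Verbatim => I0 k /\ FA v, EX u, I1_body k v u
  | Nonzero => I0 k /\ FA v, 0 < v --> EX u, 0 < u /\ I1_body k v u
  end.

Definition I2 (rd : reading) (k : tm) : fm :=
  I1 rd k /\
  FA u v v' x, EX u',
    ((FA i, 0 < i /\ i <= k --> dvd i v') /\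
     v <= v' /\
     x <= (k + 1) * v' /\
     (FA i, i <= k --> EX r, is_rem u (1 + i * v) r)) -->
    ((FA i, i <= k -->
        EX r, is_rem u (1 + i * v) r /\ is_rem u' (1 + i * v') r) /\
     is_rem u' (1 + (k + 1) * v') x).

Definition I3 (rd : reading) (k : tm) : fm :=
  I2 rd k /\
  FA w', EX w, FA i, i < k --> FA x, beta x i w <-> beta' x i w'.

(* Main.v *)
(* By the completeness theorem for natural deduction it suffices to argue in an
   arbitrary model M of PA^-, which is an ordered commutative semiring with
   cancellation.  There the verbatim reading of I_1 fails at 0, so only the
   nonzero one matters.  For k in N, I_3 turns the beta'-sequence of w below k
   into a genuine beta-sequence <u, v>; I_1 with v = 1 supplies a nonzero common
   multiple c of 1, ..., k; and I_2, for v' = c (v + x) and the given x, yields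
   u' such that <u', v'> codes the first k entries followed by x.  All its
   entries up to k exist, so beta and beta' agree there.  The axioms of Q hold
   in N because I_0 provides the differences, which lie in the cut N. *)

From Stdlib Require Import List Arith Lia Ring Cantor Classical ClassicalEpsilon.
From Stdlib Require Import FunctionalExtensionality PropExtensionality ProofIrrelevance.
Require Import Defs.
Import ListNotations.

(** * Substitution *)

Lemma up_Var : up Var = Var.
Proof. extensionality n; now destruct n. Qed.

Lemma subst_term_Var t : subst_term Var t = t.
Proof. induction t; simpl; congruence. Qed.

Lemma subst_Var A : subst Var A = A.
Proof.
  induction A; simpl; rewrite ?subst_term_Var, ?up_Var; congruence.
Qed.

Lemma subst_term_comp s r t :
  subst_term s (subst_term r t) = subst_term (fun n => subst_term s (r n)) t.
Proof. induction t; simpl; congruence. Qed.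

Lemma up_comp s r :
  (fun n => subst_term (up s) (up r n)) = up (fun n => subst_term s (r n)).
Proof.
  extensionality n; destruct n; simpl; [reflexivity|].
  now rewrite !subst_term_comp.
Qed.

Lemma subst_comp s r A :
  subst s (subst r A) = subst (fun n => subst_term s (r n)) A.
Proof.
  revert s r; induction A; intros; simpl;
    rewrite ?subst_term_comp, ?IHA, ?IHA1, ?IHA2, ?up_comp; reflexivity.
Qed.

Lemma inst_shift_term s t : subst_term (scons t Var) (subst_term shift s) = s.
Proof. rewrite subst_term_comp; apply subst_term_Var. Qed.

Lemma subst_inst s A t : subst s (inst A t) = inst (subst (up s) A) (subst_term s t).
Proof.
  unfold inst; rewrite !subst_comp; f_equal; extensionality n.
  destruct n; simpl; [reflexivity|].
  now rewrite inst_shift_term.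
Qed.

Lemma inst_subst_up s A t : inst (subst (up s) A) t = subst (scons t s) A.
Proof.
  unfold inst; rewrite subst_comp; f_equal; extensionality n.
  destruct n; simpl; [reflexivity|].
  now rewrite inst_shift_term.
Qed.

Lemma subst_term_bounded n s r t :
  bounded_term n t -> (forall m, m < n -> s m = r m) ->
  subst_term s t = subst_term r t.
Proof. induction t; simpl; intros; f_equal; intuition. Qed.

Lemma subst_bounded n s r A :
  bounded n A -> (forall m, m < n -> s m = r m) -> subst s A = subst r A.
Proof.
  revert n s r; induction A; simpl; intros n s' r' HA E; f_equal;
    try (eapply subst_term_bounded; [|eassumption]; tauto);
    try (now intuition eauto).
  apply (IHA (S n)); [assumption|].
  intros [|m] Hm; simpl; [reflexivity|]; rewrite E by lia; reflexivity.
Qed.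

Lemma subst_closed s A : bounded 0 A -> subst s A = A.
Proof.
  intros HA; rewrite <- (subst_Var A) at 2.
  apply (subst_bounded 0); [assumption|lia].
Qed.

Lemma bounded_term_mono n m t : n <= m -> bounded_term n t -> bounded_term m t.
Proof. induction t; simpl; intuition lia. Qed.

Lemma bounded_mono n m A : n <= m -> bounded n A -> bounded m A.
Proof.
  revert n m; induction A; simpl; intros p q Hpq; intuition eauto using bounded_term_mono.
  apply (IHA (S p)); [lia|assumption].
Qed.

Lemma bounded_term_exists t : exists n, bounded_term n t.
Proof.
  induction t as [n| | |s [n Hn] t [m Hm]|s [n Hn] t [m Hm]]; simpl;
    try (now exists 0); try (exists (n + m); split;
      [apply (bounded_term_mono n)|apply (bounded_term_mono m)]; auto; lia).
  exists (S n); lia.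
Qed.

Lemma bounded_exists A : exists n, bounded n A.
Proof.
  induction A as [|s t|s t|A [n Hn] B [m Hm]|A [n Hn]]; simpl.
  - now exists 0.
  - destruct (bounded_term_exists s) as [n Hn], (bounded_term_exists t) as [m Hm].
    exists (n + m); split; [apply (bounded_term_mono n)|apply (bounded_term_mono m)]; auto; lia.
  - destruct (bounded_term_exists s) as [n Hn], (bounded_term_exists t) as [m Hm].
    exists (n + m); split; [apply (bounded_term_mono n)|apply (bounded_term_mono m)]; auto; lia.
  - exists (n + m); split; [apply (bounded_mono n)|apply (bounded_mono m)]; auto; lia.
  - exists n; apply (bounded_mono n); auto.
Qed.

Lemma bounded_list_exists G : exists n, Forall (bounded n) G.
Proof.
  induction G as [|A G [n Hn]]; [now exists 0|].
  destruct (bounded_exists A) as [m Hm].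
  exists (n + m); constructor.
  - apply (bounded_mono m); [lia|assumption].
  - eapply Forall_impl; [|eassumption]; intros B; apply bounded_mono; lia.
Qed.

(** * Natural deduction *)

Definition closed_theory (T : form -> Prop) : Prop := forall A, T A -> bounded 0 A.

Lemma derives_weaken T G G' A : derives T G A -> incl G G' -> derives T G' A.
Proof.
  intros H; revert G'; induction H; intros G' HG.
  - now apply Axm.
  - apply Hyp; auto.
  - apply ImpI, IHderives; intros C [<-|HC]; simpl; auto.
  - eapply ImpE; eauto.
  - apply Raa, IHderives; intros C [<-|HC]; simpl; auto.
  - apply AllI, IHderives, incl_map, HG.
  - apply AllE; auto.
  - apply EqRefl.
  - eapply EqSubst; eauto.
Qed.

Lemma derives_subst T G A s :
  closed_theory T -> derives T G A -> derives T (map (subst s) G) (subst s A).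
Proof.
  intros HT H; revert s; induction H; intros r; simpl in *.
  - rewrite subst_closed by auto; now apply Axm.
  - apply Hyp, in_map, H.
  - apply ImpI, IHderives.
  - eapply ImpE; [apply IHderives1|apply IHderives2].
  - apply Raa, IHderives.
  - apply AllI.
    replace (map (subst shift) (map (subst r) G))
      with (map (subst (up r)) (map (subst shift) G)); [apply IHderives|].
    rewrite !map_map; apply map_ext; intros B; rewrite !subst_comp; reflexivity.
  - rewrite subst_inst; apply AllE, IHderives.
  - apply EqRefl.
  - rewrite subst_inst in *; eapply EqSubst; [apply IHderives1|].
    rewrite <- subst_inst; apply IHderives2.
Qed.

Lemma derives_generalize T G A m :
  closed_theory T -> Forall (bounded m) G -> bounded m A ->
  derives T G (inst A (Var m)) -> derives T G (All A).
Proof.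
  intros HT HG HA H.
  set (s := fun k => if k =? m then Var 0 else Var (S k)).
  assert (Hs : forall k, k < m -> s k = Var (S k)).
  { intros k Hk; unfold s; destruct (Nat.eqb_spec k m); [lia|reflexivity]. }
  apply AllI.
  apply (derives_subst _ _ _ s HT) in H.
  replace (map (subst shift) G) with (map (subst s) G).
  - replace (subst s (inst A (Var m))) with A in H; [exact H|].
    unfold inst; rewrite subst_comp, <- (subst_Var A) at 1.
    apply (subst_bounded m); [assumption|].
    intros [|k] Hk; simpl; unfold s; [now rewrite Nat.eqb_refl|].
    destruct (Nat.eqb_spec k m); [lia|reflexivity].
  - apply map_ext_in; intros B HB; apply (subst_bounded m); [|exact Hs].
    rewrite Forall_forall in HG; auto.
Qed.

Lemma derives_explosion T G A : derives T G Bot -> derives T G A.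
Proof.
  intros H; apply Raa; eapply derives_weaken; [exact H|]; intros C; simpl; auto.
Qed.

Lemma derives_cut T G A B : derives T G A -> derives T (A :: G) B -> derives T G B.
Proof. intros HA HB; eapply ImpE; [apply ImpI, HB|exact HA]. Qed.

(** * Tarskian semantics *)

Record structure : Type := {
  carrier :> Type;
  czero : carrier;
  cone : carrier;
  cadd : carrier -> carrier -> carrier;
  cmul : carrier -> carrier -> carrier;
  cle : carrier -> carrier -> Prop
}.

Definition econs {X : Type} (x : X) (e : nat -> X) (n : nat) : X :=
  match n with O => x | S n => e n end.

Section Semantics.
Context (M : structure).

Fixpoint eval (e : nat -> M) (t : term) : M :=
  match t with
  | Var n => e n
  | Zero => czero M
  | One => cone M
  | Add s t => cadd M (eval e s) (eval e t)
  | Mul s t => cmul M (eval e s) (eval e t)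
  end.

Fixpoint sat (e : nat -> M) (A : form) : Prop :=
  match A with
  | Bot => False
  | Eq s t => eval e s = eval e t
  | Le s t => cle M (eval e s) (eval e t)
  | Imp A B => sat e A -> sat e B
  | All A => forall x, sat (econs x e) A
  end.

Lemma eval_subst e s t : eval e (subst_term s t) = eval (fun n => eval e (s n)) t.
Proof. induction t; simpl; congruence. Qed.

Lemma eval_up e s x :
  (fun n => eval (econs x e) (up s n)) = econs x (fun n => eval e (s n)).
Proof. extensionality n; destruct n; simpl; [|rewrite eval_subst]; reflexivity. Qed.

Lemma sat_subst e s A : sat e (subst s A) <-> sat (fun n => eval e (s n)) A.
Proof.
  revert e s; induction A; intros; simpl; rewrite ?eval_subst; try tauto.
  - now rewrite IHA1, IHA2.
  - split; intros H x; specialize (H x); rewrite IHA, eval_up in *; exact H.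
Qed.

Lemma sat_inst e A t : sat e (inst A t) <-> sat (econs (eval e t) e) A.
Proof.
  unfold inst; rewrite sat_subst.
  replace (fun n => eval e (scons t Var n)) with (econs (eval e t) e); [tauto|].
  extensionality n; now destruct n.
Qed.

Lemma eval_bounded n e e' t :
  bounded_term n t -> (forall m, m < n -> e m = e' m) -> eval e t = eval e' t.
Proof. induction t; simpl; intros; f_equal; intuition. Qed.

Lemma sat_bounded n e e' A :
  bounded n A -> (forall m, m < n -> e m = e' m) -> sat e A <-> sat e' A.
Proof.
  revert n e e'; induction A; simpl; intros n e e' HA E.
  - tauto.
  - rewrite (eval_bounded n e e' s), (eval_bounded n e e' t); tauto.
  - rewrite (eval_bounded n e e' s), (eval_bounded n e e' t); tauto.
  - rewrite (IHA1 n e e'), (IHA2 n e e'); tauto.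
  - assert (H : forall x, sat (econs x e) A <-> sat (econs x e') A); [|firstorder].
    intros x; apply (IHA (S n)); [assumption|].
    intros [|m] Hm; simpl; [reflexivity|]; apply E; lia.
Qed.

Definition models (T : form -> Prop) : Prop := forall A e, T A -> sat e A.

Lemma soundness_context T G A e :
  models T -> derives T G A -> (forall B, In B G -> sat e B) -> sat e A.
Proof.
  intros HT H; revert e; induction H; intros e HG; simpl in *.
  - now apply HT.
  - auto.
  - intros HA; apply IHderives; intros C [<-|HC]; auto.
  - apply IHderives1; auto.
  - apply NNPP; intros HA; apply (IHderives e); intros C [<-|HC]; auto.
  - intros x; apply IHderives; intros B HB.
    apply in_map_iff in HB as (C & <- & HC); apply sat_subst; simpl; auto.
  - apply sat_inst, IHderives, HG.
  - reflexivity.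
  - apply sat_inst; rewrite <- IHderives1 by assumption; apply sat_inst; auto.
Qed.

End Semantics.

Lemma soundness T A (M : structure) e : models M T -> provable T A -> sat M e A.
Proof. intros HT H; apply (soundness_context M T [] A e HT H); simpl; tauto. Qed.

(** * Completeness *)

Fixpoint code_term (t : term) : nat :=
  match t with
  | Var n => to_nat (0, n)
  | Zero => to_nat (1, 0)
  | One => to_nat (2, 0)
  | Add s t => to_nat (3, to_nat (code_term s, code_term t))
  | Mul s t => to_nat (4, to_nat (code_term s, code_term t))
  end.

Fixpoint code (A : form) : nat :=
  match A with
  | Bot => to_nat (0, 0)
  | Eq s t => to_nat (1, to_nat (code_term s, code_term t))
  | Le s t => to_nat (2, to_nat (code_term s, code_term t))
  | Imp A B => to_nat (3, to_nat (code A, code B))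
  | All A => to_nat (4, code A)
  end.

Lemma to_nat_pair_inj a b c d : to_nat (a, b) = to_nat (c, d) -> a = c /\ b = d.
Proof. intros H; now apply to_nat_inj, pair_equal_spec in H. Qed.

Lemma code_term_inj s t : code_term s = code_term t -> s = t.
Proof.
  revert t; induction s; intros [] H; cbn [code_term] in H;
    apply to_nat_pair_inj in H as [Hc H]; try discriminate Hc; try congruence;
    apply to_nat_pair_inj in H as [H1 H2]; f_equal; auto.
Qed.

Lemma code_inj A B : code A = code B -> A = B.
Proof.
  revert B; induction A; intros [] H; cbn [code] in H;
    apply to_nat_pair_inj in H as [Hc H]; try discriminate Hc; try reflexivity;
    try apply to_nat_pair_inj in H as [H1 H2]; f_equal; auto using code_term_inj.
Qed.

Definition enum (n : nat) : form := epsilon (inhabits Bot) (fun A => code A = n).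

Lemma enum_code A : enum (code A) = A.
Proof.
  apply code_inj; unfold enum.
  apply (epsilon_spec (inhabits Bot) (fun B => code B = code A)); now exists A.
Qed.

Section Henkin.
Context (T : form -> Prop) (T_closed : closed_theory T).
Context (G0 : list form) (G0_consistent : ~ derives T G0 Bot).

(* The variables play the role of Henkin constants: every stage is a finite
   list, so a fresh one is always available. *)
Definition fresh (G : list form) : nat :=
  epsilon (inhabits 0) (fun n => Forall (bounded n) G).

Lemma fresh_spec G : Forall (bounded (fresh G)) G.
Proof.
  apply (epsilon_spec (inhabits 0) (fun n => Forall (bounded n) G)).
  apply bounded_list_exists.
Qed.

Definition step (G : list form) (A : form) : list form :=
  if excluded_middle_informative (derives T (A :: G) Bot) then
    match A with
    | All B => Neg (inst B (Var (fresh (A :: B :: G)))) :: G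
    | _ => G
    end
  else A :: G.

Fixpoint stage (n : nat) : list form :=
  match n with
  | O => G0
  | S n => step (stage n) (enum n)
  end.

Lemma step_incl G A : incl G (step G A).
Proof.
  unfold step; destruct excluded_middle_informative; [destruct A|]; intros B HB; simpl; auto.
Qed.

Lemma step_consistent G A : ~ derives T G Bot -> ~ derives T (step G A) Bot.
Proof.
  intros HG; unfold step; destruct excluded_middle_informative as [H|H]; [|exact H].
  destruct A as [| | | |B]; auto.
  intros H'; apply HG, (derives_cut T G (All B)); [|exact H].
  pose proof (fresh_spec (All B :: B :: G)) as F.
  inversion_clear F as [|? ? _ F']; inversion_clear F'.
  eapply derives_generalize; eauto; apply Raa, H'.
Qed.

Lemma stage_consistent n : ~ derives T (stage n) Bot.
Proof. induction n; simpl; auto using step_consistent. Qed.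

Lemma stage_incl n m : n <= m -> incl (stage n) (stage m).
Proof.
  induction 1; [apply incl_refl|]; eapply incl_tran; [eassumption|apply step_incl].
Qed.

Definition limit (A : form) : Prop := exists n, derives T (stage n) A.

Lemma limit_common A B :
  limit A -> limit B -> exists n, derives T (stage n) A /\ derives T (stage n) B.
Proof.
  intros [n Hn] [m Hm]; exists (n + m).
  split; (eapply derives_weaken; [eassumption|apply stage_incl; lia]).
Qed.

Lemma limit_Bot : ~ limit Bot.
Proof. intros [n H]; exact (stage_consistent n H). Qed.

Lemma limit_derived1 A B : (forall G, derives T G A -> derives T G B) -> limit A -> limit B.
Proof. intros H [n Hn]; exists n; auto. Qed.

Lemma limit_derived2 A B C :
  (forall G, derives T G A -> derives T G B -> derives T G C) ->
  limit A -> limit B -> limit C.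
Proof.
  intros H HA HB; destruct (limit_common A B HA HB) as (n & ? & ?); exists n; auto.
Qed.

Lemma limit_theorem A : (forall G, derives T G A) -> limit A.
Proof. intros H; now exists 0. Qed.

Lemma not_limit A :
  ~ limit A -> derives T (A :: stage (code A)) Bot /\
  stage (S (code A)) = step (stage (code A)) A.
Proof.
  intros HA; split; [|simpl; now rewrite enum_code].
  apply NNPP; intros H; apply HA; exists (S (code A)); apply Hyp; simpl.
  rewrite enum_code; unfold step; destruct excluded_middle_informative; simpl; tauto.
Qed.

Lemma limit_Imp A B : limit (Imp A B) <-> (limit A -> limit B).
Proof.
  split.
  - apply (limit_derived2 (Imp A B) A B); intros G; apply ImpE.
  - intros H; destruct (classic (limit A)) as [HA|HA].
    + specialize (H HA); revert H; apply limit_derived1.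
      intros G HB; apply ImpI; eapply derives_weaken; [exact HB|].
      intros C; simpl; auto.
    + exists (code A); apply ImpI, derives_explosion, not_limit, HA.
Qed.

Lemma limit_All A : limit (All A) <-> forall t, limit (inst A t).
Proof.
  split.
  - intros H t; revert H; apply limit_derived1; intros G; apply AllE.
  - intros H; apply NNPP; intros HA.
    destruct (not_limit _ HA) as [H1 H2]; unfold step in H2.
    destruct excluded_middle_informative as [_|n]; [|exact (n H1)].
    apply limit_Bot, (limit_Imp (inst A (Var (fresh (All A :: A :: stage (code (All A)))))) Bot); auto.
    exists (S (code (All A))); apply Hyp; rewrite H2; simpl; auto.
Qed.

Lemma limit_Eq_subst A s t : limit (Eq s t) -> limit (inst A s) -> limit (inst A t).
Proof. apply limit_derived2; intros G; apply EqSubst. Qed.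

Lemma limit_Eq_refl t : limit (Eq t t).
Proof. apply limit_theorem; intros; apply EqRefl. Qed.

Lemma limit_Eq_sym s t : limit (Eq s t) -> limit (Eq t s).
Proof.
  intros H.
  pose proof (limit_Eq_subst (Eq (Var 0) (subst_term shift s)) s t H) as K.
  unfold inst in K; simpl in K; rewrite !inst_shift_term in K.
  apply K, limit_Eq_refl.
Qed.

Lemma limit_Eq_trans s t u : limit (Eq s t) -> limit (Eq t u) -> limit (Eq s u).
Proof.
  intros H1 H2.
  pose proof (limit_Eq_subst (Eq (subst_term shift s) (Var 0)) t u H2) as K.
  unfold inst in K; simpl in K; rewrite !inst_shift_term in K; auto.
Qed.

Definition repr (t : term) : term := epsilon (inhabits Zero) (fun u => limit (Eq t u)).

Lemma repr_spec t : limit (Eq t (repr t)).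
Proof.
  apply (epsilon_spec (inhabits Zero) (fun u => limit (Eq t u))).
  exists t; apply limit_Eq_refl.
Qed.

Lemma repr_eq s t : repr s = repr t <-> limit (Eq s t).
Proof.
  split; intros H.
  - apply (limit_Eq_trans s (repr s)); [apply repr_spec|].
    rewrite H; apply limit_Eq_sym, repr_spec.
  - unfold repr; f_equal; extensionality u; apply propositional_extensionality.
    split; apply limit_Eq_trans; auto using limit_Eq_sym.
Qed.

Lemma repr_repr t : repr (repr t) = repr t.
Proof. apply repr_eq, limit_Eq_sym, repr_spec. Qed.

Definition cls (t : term) : {u | repr u = u} := exist _ (repr t) (repr_repr t).

Lemma cls_eq s t : cls s = cls t <-> limit (Eq s t).
Proof.
  rewrite <- repr_eq; unfold cls; split; intros H.
  - now injection H.
  - apply subset_eq_compat, H.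
Qed.

Lemma cls_proj1 x : cls (proj1_sig x) = x.
Proof. destruct x as [t Ht]; apply subset_eq_compat, Ht. Qed.

Definition term_model : structure := {|
  carrier := {u | repr u = u};
  czero := cls Zero;
  cone := cls One;
  cadd x y := cls (Add (proj1_sig x) (proj1_sig y));
  cmul x y := cls (Mul (proj1_sig x) (proj1_sig y));
  cle x y := limit (Le (proj1_sig x) (proj1_sig y))
|}.

Lemma limit_Add s s' t t' :
  limit (Eq s s') -> limit (Eq t t') -> limit (Eq (Add s t) (Add s' t')).
Proof.
  intros Hs Ht.
  pose proof (limit_Eq_subst
    (Eq (subst_term shift (Add s t)) (Add (Var 0) (subst_term shift t))) s s' Hs) as K1.
  pose proof (limit_Eq_subst
    (Eq (subst_term shift (Add s t)) (Add (subst_term shift s') (Var 0))) t t' Ht) as K2.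
  unfold inst in K1, K2; simpl in K1, K2; repeat rewrite inst_shift_term in *.
  apply K2, K1, limit_Eq_refl.
Qed.

Lemma limit_Mul s s' t t' :
  limit (Eq s s') -> limit (Eq t t') -> limit (Eq (Mul s t) (Mul s' t')).
Proof.
  intros Hs Ht.
  pose proof (limit_Eq_subst
    (Eq (subst_term shift (Mul s t)) (Mul (Var 0) (subst_term shift t))) s s' Hs) as K1.
  pose proof (limit_Eq_subst
    (Eq (subst_term shift (Mul s t)) (Mul (subst_term shift s') (Var 0))) t t' Ht) as K2.
  unfold inst in K1, K2; simpl in K1, K2; repeat rewrite inst_shift_term in *.
  apply K2, K1, limit_Eq_refl.
Qed.

Lemma limit_Le s s' t t' :
  limit (Eq s s') -> limit (Eq t t') -> limit (Le s t) -> limit (Le s' t').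
Proof.
  intros Hs Ht.
  pose proof (limit_Eq_subst (Le (Var 0) (subst_term shift t)) s s' Hs) as K1.
  pose proof (limit_Eq_subst (Le (subst_term shift s') (Var 0)) t t' Ht) as K2.
  unfold inst in K1, K2; simpl in K1, K2; repeat rewrite inst_shift_term in *; auto.
Qed.

Lemma eval_term_model e s t :
  (forall n, e n = cls (s n)) -> eval term_model e t = cls (subst_term s t).
Proof.
  intros E; induction t; simpl; rewrite ?IHt1, ?IHt2; auto;
    apply cls_eq; [apply limit_Add|apply limit_Mul];
    apply limit_Eq_sym, repr_spec.
Qed.

Lemma sat_term_model e s A :
  (forall n, e n = cls (s n)) -> sat term_model e A <-> limit (subst s A).
Proof.
  revert e s; induction A; intros e r E; simpl.
  - split; [tauto|apply limit_Bot].
  - rewrite !(eval_term_model e r) by assumption; apply cls_eq.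
  - rewrite !(eval_term_model e r) by assumption; simpl.
    split; apply limit_Le; auto using limit_Eq_sym, repr_spec.
  - rewrite limit_Imp, (IHA1 e r), (IHA2 e r) by assumption; tauto.
  - rewrite limit_All.
    split; intros H.
    + intros t; rewrite inst_subst_up; apply (IHA (econs (cls t) e)); [|apply H].
      intros [|n]; simpl; auto.
    + intros x; apply (IHA _ (scons (proj1_sig x) r)).
      * intros [|n]; simpl; [symmetry; apply cls_proj1|auto].
      * rewrite <- inst_subst_up; apply H.
Qed.

Lemma term_model_models : models term_model T.
Proof.
  intros A e HA; apply (sat_term_model e (fun n => proj1_sig (e n))).
  - intros n; symmetry; apply cls_proj1.
  - rewrite subst_closed by auto; apply limit_theorem; intros G; now apply Axm.
Qed.

Lemma term_model_context A :
  In A G0 -> sat term_model (fun n => cls (Var n)) A.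
Proof.
  intros HA; apply (sat_term_model _ Var); [reflexivity|].
  rewrite subst_Var; exists 0; now apply Hyp.
Qed.

End Henkin.

Theorem completeness T A :
  closed_theory T -> (forall (M : structure) e, models M T -> sat M e A) -> provable T A.
Proof.
  intros HT H; apply Raa, NNPP; intros HC.
  pose proof (term_model_context T HT [Neg A] HC (Neg A) (or_introl eq_refl)) as HA.
  apply HA, H, term_model_models; assumption.
Qed.

(** * Reading formulas in a structure *)

Definition means (M : structure) (e : nat -> M) (A : form) (P : Prop) : Prop :=
  sat M e A <-> P.

Section Reading.
Context {M : structure}.
Implicit Types (e : nat -> M) (A B N : form) (P Q : Prop).

Lemma means_Imp e A B P Q :
  means M e A P -> means M e B Q -> means M e (Imp A B) (P -> Q).
Proof. unfold means; simpl; tauto. Qed.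

Lemma means_Neg e A P : means M e A P -> means M e (Neg A) (~ P).
Proof. unfold means; simpl; tauto. Qed.

Lemma means_Or e A B P Q :
  means M e A P -> means M e B Q -> means M e (Or A B) (P \/ Q).
Proof. unfold means; simpl; intros -> ->; tauto. Qed.

Lemma means_And e A B P Q :
  means M e A P -> means M e B Q -> means M e (And A B) (P /\ Q).
Proof. unfold means; simpl; intros -> ->; tauto. Qed.

Lemma means_Iff e A B P Q :
  means M e A P -> means M e B Q -> means M e (Iff A B) (P <-> Q).
Proof. intros HA HB; now apply means_And; apply means_Imp. Qed.

Lemma means_All e A (P : M -> Prop) :
  (forall x, means M (econs x e) A (P x)) -> means M e (All A) (forall x, P x).
Proof. intros H; split; intros K x; apply (H x), K. Qed.

Lemma means_Ex e A (P : M -> Prop) :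
  (forall x, means M (econs x e) A (P x)) -> means M e (Ex A) (exists x, P x).
Proof.
  intros H; unfold Ex; split.
  - intros K; apply NNPP; intros HP; apply K; intros x Hx.
    apply HP; exists x; apply (H x), Hx.
  - intros [x Hx] K; apply (K x), (H x), Hx.
Qed.

Lemma means_subst e s A P :
  means M (fun n => eval M e (s n)) A P -> means M e (subst s A) P.
Proof. intros H; unfold means; now rewrite sat_subst. Qed.

Definition defset (N : form) (a : M) : Prop := sat M (fun _ => a) N.

Lemma means_defset e N : bounded 1 N -> means M e N (defset N (e 0)).
Proof.
  intros HN; apply (sat_bounded M 1); [assumption|].
  intros m Hm; now replace m with 0 by lia.
Qed.

Lemma means_app1 e N s (a : M) :
  bounded 1 N -> eval M e s = a -> means M e (subst (scons s Var) N) (defset N a).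
Proof.
  intros HN <-; apply means_subst.
  apply (means_defset (fun n => eval M e (scons s Var n)) N HN).
Qed.

Lemma means_rel_All e N A (P : M -> Prop) :
  bounded 1 N ->
  (forall x, means M (econs x e) (relativize N A) (P x)) ->
  means M e (relativize N (All A)) (forall x, defset N x -> P x).
Proof.
  intros HN H; cbn [relativize]; apply means_All; intros x.
  apply means_Imp; [apply (means_defset (econs x e) N HN)|apply H].
Qed.

Lemma means_rel_Ex e N A (P : M -> Prop) :
  bounded 1 N ->
  (forall x, means M (econs x e) (relativize N A) (P x)) ->
  means M e (relativize N (Ex A)) (exists x, defset N x /\ P x).
Proof.
  intros HN H.
  assert (K : means M e (relativize N (Ex A)) (~ forall x, defset N x -> ~ P x)).
  { apply means_Neg, (means_rel_All e N (Neg A) (fun x => ~ P x) HN).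
    intros x; apply means_Neg, H. }
  unfold means in *; rewrite K; split.
  - intros L; apply NNPP; intros L'; apply L; intros x Hx Px; apply L'; eauto.
  - intros (x & Hx & Px) L; exact (L x Hx Px).
Qed.

Lemma means_rel_Imp e N A B P Q :
  means M e (relativize N A) P -> means M e (relativize N B) Q ->
  means M e (relativize N (Imp A B)) (P -> Q).
Proof. apply means_Imp. Qed.

Lemma means_rel_Neg e N A P :
  means M e (relativize N A) P -> means M e (relativize N (Neg A)) (~ P).
Proof. apply means_Neg. Qed.

Lemma means_rel_Iff e N A B P Q :
  means M e (relativize N A) P -> means M e (relativize N B) Q ->
  means M e (relativize N (Iff A B)) (P <-> Q).
Proof. apply means_Iff. Qed.

End Reading.

Ltac expand_macros :=
  cbv beta delta [cut closed_add_mul inductive sequence_extension app1 app3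
    I3 I2 I1 I1_body I0 is_rem dvd beta' beta pair lt all ex].

(* [means M e A P] with [A] built by the macros and [P] its intended reading,
   which may be folded: unification unfolds it. *)
Ltac read :=
  expand_macros;
  repeat lazymatch goal with
  | |- means _ _ (relativize _ (All _)) _ => apply means_rel_All; [assumption|intros ?]
  | |- means _ _ (relativize _ (Ex _)) _ => apply means_rel_Ex; [assumption|intros ?]
  | |- means _ _ (relativize _ (Imp _ _)) _ => apply means_rel_Imp
  | |- means _ _ (relativize _ (Neg _)) _ => apply means_rel_Neg
  | |- means _ _ (relativize _ (Iff _ _)) _ => apply means_rel_Iff
  | |- means _ _ (All _) _ => apply means_All; intros ?
  | |- means _ _ (Ex _) _ => apply means_Ex; intros ?
  | |- means _ _ (Imp _ _) _ => apply means_Imp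
  | |- means _ _ (Neg _) _ => apply means_Neg
  | |- means _ _ (Or _ _) _ => apply means_Or
  | |- means _ _ (And _ _) _ => apply means_And
  | |- means _ _ (Iff _ _) _ => apply means_Iff
  | |- means _ _ (subst (scons _ Var) ?N) _ => apply means_app1; [assumption|reflexivity]
  | |- means _ _ _ _ => exact (iff_refl _)
  end.

(** * Arithmetic in a model of PA^- *)

Section Model.
Context (M : structure) (M_models : models M PAminus).

Declare Scope model_scope.
Local Notation "0" := (czero M) : model_scope.
Local Notation "1" := (cone M) : model_scope.
Local Notation "x + y" := (cadd M x y) : model_scope.
Local Notation "x * y" := (cmul M x y) : model_scope.
Local Notation "x <= y" := (cle M x y) : model_scope.
Definition clt (x y : M) : Prop := cle M x y /\ x <> y.
Local Notation "x < y" := (clt x y) : model_scope.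
Local Open Scope model_scope.
Implicit Types x y z u v w i j k d q m : M.

Lemma PAminus_holds (n : nat) P :
  means M (fun _ => 0) (nth n PAminus_axioms (fun _ => Neg Bot) O) P ->
  (n < length PAminus_axioms)%nat -> P.
Proof.
  intros H Hn; apply H, M_models.
  exists (nth n PAminus_axioms (fun _ => Neg Bot)); split; [now apply nth_In|reflexivity].
Qed.

Ltac by_axiom n :=
  apply (PAminus_holds n); [cbn [nth PAminus_axioms]; read|cbn; lia].

Lemma add_0 : forall x, x + 0 = x.
Proof. by_axiom 0%nat. Qed.

Lemma add_comm : forall x y, x + y = y + x.
Proof. by_axiom 1%nat. Qed.

Lemma add_assoc : forall x y z, (x + y) + z = x + (y + z).
Proof. by_axiom 2%nat. Qed.

Lemma mul_1 : forall x, x * 1 = x.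
Proof. by_axiom 3%nat. Qed.

Lemma mul_comm : forall x y, x * y = y * x.
Proof. by_axiom 4%nat. Qed.

Lemma mul_assoc : forall x y z, (x * y) * z = x * (y * z).
Proof. by_axiom 5%nat. Qed.

Lemma mul_add : forall x y z, x * (y + z) = x * y + x * z.
Proof. by_axiom 6%nat. Qed.

Lemma le_total : forall x y, x <= y \/ y <= x.
Proof. by_axiom 7%nat. Qed.

Lemma le_trans y x z : x <= y -> y <= z -> x <= z.
Proof.
  intros H1 H2; enough (H : forall x y z, x <= y /\ y <= z -> x <= z) by eauto.
  by_axiom 8%nat.
Qed.

Lemma not_succ_le : forall x, ~ x + 1 <= x.
Proof. by_axiom 9%nat. Qed.

Lemma le_eq_or_succ_le : forall x y, x <= y -> x = y \/ x + 1 <= y.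
Proof. by_axiom 10%nat. Qed.

Lemma add_le_r : forall x y z, x <= y -> x + z <= y + z.
Proof. by_axiom 11%nat. Qed.

Lemma mul_le_r : forall x y z, x <= y -> x * z <= y * z.
Proof. by_axiom 12%nat. Qed.

Lemma le_refl x : x <= x.
Proof. destruct (le_total x x); assumption. Qed.

Lemma le_succ x : x <= x + 1.
Proof. destruct (le_total x (x + 1)) as [H|H]; [assumption|now apply not_succ_le in H]. Qed.

Lemma le_or_succ_le x y : x <= y \/ y + 1 <= x.
Proof.
  destruct (le_total x y) as [H|H]; [now left|].
  destruct (le_eq_or_succ_le _ _ H) as [->|H']; [left; apply le_refl|now right].
Qed.

Lemma succ_le_not_le x y : x + 1 <= y -> ~ y <= x.
Proof. intros H1 H2; apply (not_succ_le x), (le_trans y); assumption. Qed.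

Lemma lt_iff_succ_le x y : x < y <-> x + 1 <= y.
Proof.
  split.
  - intros [H1 H2]; destruct (le_eq_or_succ_le _ _ H1); tauto.
  - intros H; split; [apply (le_trans (x + 1)); auto using le_succ|].
    intros <-; exact (not_succ_le _ H).
Qed.

Lemma add_le x y z w : x <= y -> z <= w -> x + z <= y + w.
Proof.
  intros H1 H2; apply (le_trans (y + z)); [now apply add_le_r|].
  rewrite (add_comm y z), (add_comm y w); now apply add_le_r.
Qed.

Lemma succ_add x z : x + z + 1 = (x + 1) + z.
Proof. now rewrite !add_assoc, (add_comm z 1). Qed.

Lemma add_le_cancel x y z : x + z <= y + z -> x <= y.
Proof.
  intros H; destruct (le_or_succ_le x y) as [L|L]; [assumption|].
  apply (add_le_r _ _ z) in L; rewrite <- succ_add in L.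
  now apply succ_le_not_le in L.
Qed.

Lemma le_antisym x y : x <= y -> y <= x -> x = y.
Proof.
  intros H1 H2; destruct (le_eq_or_succ_le _ _ H1) as [|H]; [assumption|].
  now apply succ_le_not_le in H.
Qed.

Lemma add_cancel x y z : x + z = y + z -> x = y.
Proof.
  intros H; apply le_antisym; apply (add_le_cancel _ _ z); rewrite H; apply le_refl.
Qed.

Lemma mul_0 x : x * 0 = 0.
Proof.
  apply (add_cancel _ _ (x * 1)).
  now rewrite <- mul_add, !(add_comm 0), !add_0.
Qed.

Lemma model_semiring : semi_ring_theory 0 1 (cadd M) (cmul M) (@eq M).
Proof.
  constructor; intros.
  - rewrite add_comm; apply add_0.
  - apply add_comm.
  - symmetry; apply add_assoc.
  - rewrite mul_comm; apply mul_1.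
  - rewrite mul_comm; apply mul_0.
  - apply mul_comm.
  - symmetry; apply mul_assoc.
  - rewrite mul_comm, mul_add; f_equal; apply mul_comm.
Qed.

Add Ring model_ring : model_semiring.

Lemma le_0 x : 0 <= x.
Proof.
  replace 0 with (0 * x) by ring; replace x with (1 * x) at 2 by ring.
  apply mul_le_r; replace 1 with (0 + 1) by ring; apply le_succ.
Qed.

Lemma pos_iff x : 0 < x <-> 1 <= x.
Proof. rewrite lt_iff_succ_le; now replace (0 + 1) with 1 by ring. Qed.

Lemma le_add x y : x <= x + y.
Proof.
  replace x with (x + 0) at 1 by ring; apply add_le; [apply le_refl|apply le_0].
Qed.

Lemma mul_le x y z w : x <= y -> z <= w -> x * z <= y * w.
Proof.
  intros H1 H2; apply (le_trans (y * z)); [now apply mul_le_r|].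
  rewrite (mul_comm y z), (mul_comm y w); now apply mul_le_r.
Qed.

Lemma eq_or_succ_le x y : x = y \/ x + 1 <= y \/ y + 1 <= x.
Proof.
  destruct (le_or_succ_le x y) as [H|H]; [|tauto].
  destruct (le_eq_or_succ_le _ _ H); tauto.
Qed.

Lemma le_iff_lt_or_eq x y : x <= y <-> x < y \/ x = y.
Proof.
  split.
  - intros H; destruct (classic (x = y)); [now right|now left].
  - intros [[H _]|<-]; auto using le_refl.
Qed.

Definition crem (x y z : M) : Prop := z < y /\ exists q, x = z + q * y.

Lemma crem_neq_of_quotient_lt m r r' q q' :
  r < m -> q + 1 <= q' -> r + q * m <> r' + q' * m.
Proof.
  intros Hr Hq E; apply lt_iff_succ_le in Hr.
  apply (succ_le_not_le (r + q * m) (q' * m)).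
  - apply (le_trans ((q + 1) * m)); [|now apply mul_le_r].
    replace (r + q * m + 1) with ((r + 1) + q * m) by ring.
    replace ((q + 1) * m) with (m + q * m) by ring; now apply add_le_r.
  - rewrite E, (add_comm r'); apply le_add.
Qed.

Lemma crem_unique u m r r' : crem u m r -> crem u m r' -> r = r'.
Proof.
  intros [Hr [q E]] [Hr' [q' E']]; rewrite E in E'.
  destruct (eq_or_succ_le q q') as [<-|[H|H]].
  - exact (add_cancel _ _ _ E').
  - now apply crem_neq_of_quotient_lt in E'.
  - symmetry in E'; now apply crem_neq_of_quotient_lt in E'.
Qed.

Definition cpair (x y : M) : M := (x + y) * (x + y) + x.

Lemma cpair_neq_of_sum_lt x y x' y' : (x + y) + 1 <= x' + y' -> cpair x y <> cpair x' y'.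
Proof.
  intros H E; apply (succ_le_not_le (cpair x y) (cpair x' y')); [|rewrite E; apply le_refl].
  apply (le_trans ((x' + y') * (x' + y'))); [|apply le_add].
  apply (le_trans ((x + y + 1) * (x + y + 1))); [|now apply mul_le].
  unfold cpair.
  replace ((x + y + 1) * (x + y + 1))
    with ((x + y) * (x + y) + x + 1 + (x + y + y)) by ring.
  apply le_add.
Qed.

Lemma cpair_inj x y x' y' : cpair x y = cpair x' y' -> x = x' /\ y = y'.
Proof.
  intros E; destruct (eq_or_succ_le (x + y) (x' + y')) as [S|[H|H]].
  - unfold cpair in E; rewrite S, !(add_comm (_ * _)) in E; apply add_cancel in E as <-.
    split; [reflexivity|]; rewrite !(add_comm x) in S; exact (add_cancel _ _ _ S).
  - now apply cpair_neq_of_sum_lt in E.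
  - symmetry in E; now apply cpair_neq_of_sum_lt in E.
Qed.

Definition cbeta (x i w : M) : Prop :=
  exists u v q, w = cpair u v /\ u = q * (1 + (i + 1) * v) + x /\ x <= (i + 1) * v.

Lemma cbeta_cpair x i u v : cbeta x i (cpair u v) <-> crem u (1 + (i + 1) * v) x.
Proof.
  assert (L : x < 1 + (i + 1) * v <-> x <= (i + 1) * v).
  { rewrite lt_iff_succ_le, (add_comm 1); split;
      [apply add_le_cancel|intros; now apply add_le_r]. }
  unfold crem; rewrite L; split.
  - intros (u' & v' & q & E & Hu & Hx); apply cpair_inj in E as [<- <-].
    split; [assumption|]; exists q; rewrite Hu at 1; ring.
  - intros (Hx & q & Hu); exists u, v, q; repeat split; [|assumption].
    rewrite Hu at 1; ring.
Qed.

Definition cbeta' (x i w : M) : Prop :=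
  (cbeta x i w /\ forall j, j < i -> exists y, cbeta y j w) \/
  (x = 0 /\ exists j, j <= i /\ ~ exists y, cbeta y j w).

Lemma cbeta'_total i w : exists x, cbeta' x i w.
Proof.
  destruct (classic (exists j, j <= i /\ ~ exists y, cbeta y j w)) as [H|H].
  - exists 0; now right.
  - assert (K : forall j, j <= i -> exists y, cbeta y j w).
    { intros j Hj; apply NNPP; intros L; apply H; now exists j. }
    destruct (K i (le_refl i)) as [x Hx]; exists x; left; split; [assumption|].
    intros j [Hj _]; auto.
Qed.

Lemma cbeta'_cbeta x i w :
  (forall j, j <= i -> exists y, cbeta y j w) -> cbeta' x i w <-> cbeta x i w.
Proof.
  intros H; split.
  - intros [[Hx _]|(_ & j & Hj & Hn)]; [assumption|]; now apply H in Hj.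
  - intros Hx; left; split; [assumption|]; intros j [Hj _]; auto.
Qed.

Definition cdvd (y x : M) : Prop := exists q, x = q * y.

Definition cI0 (k : M) : Prop :=
  forall i j, j <= i /\ i <= k -> exists d, d + j = i.

Definition cI1_body (k v u : M) : Prop :=
  (forall i, i <= k -> cdvd (1 + i * v) u) /\
  (forall i, k < i ->
     (cI0 i /\ forall j, 0 < j /\ j <= k -> exists d, d + j = i /\ cdvd d v) ->
     exists p, crem (u * p) (1 + i * v) 1).

Definition cI1 (rd : reading) (k : M) : Prop :=
  match rd with
  | Verbatim => cI0 k /\ forall v, exists u, cI1_body k v u
  | Nonzero => cI0 k /\ forall v, 0 < v -> exists u, 0 < u /\ cI1_body k v u
  end.

Definition cI2 (rd : reading) (k : M) : Prop :=
  cI1 rd k /\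
  forall u v v' x, exists u',
    ((forall i, 0 < i /\ i <= k -> cdvd i v') /\
     v <= v' /\
     x <= (k + 1) * v' /\
     (forall i, i <= k -> exists r, crem u (1 + i * v) r)) ->
    ((forall i, i <= k ->
        exists r, crem u (1 + i * v) r /\ crem u' (1 + i * v') r) /\
     crem u' (1 + (k + 1) * v') x).

Definition cI3 (rd : reading) (k : M) : Prop :=
  cI2 rd k /\
  forall w', exists w, forall i, i < k -> forall x, cbeta x i w <-> cbeta' x i w'.

Lemma cI1_0_verbatim_absurd : ~ cI1 Verbatim 0.
Proof.
  intros [_ H]; destruct (H 0) as [u [_ Hu]].
  destruct (Hu 1) as [p [Hp _]].
  - apply pos_iff, le_refl.
  - split.
    + intros i j [Hj Hi].
      destruct (eq_or_succ_le i j) as [<-|[L|L]].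
      * exists 0; ring.
      * now apply succ_le_not_le in L.
      * exists 1.
        assert (j = 0) as ->.
        { apply le_antisym; [|apply le_0]; apply (add_le_cancel _ _ 1).
          apply (le_trans i), (le_trans 1); auto.
          replace 1 with (0 + 1) at 1 by ring; apply le_refl. }
        replace (1 + 0) with (0 + 1) by ring.
        apply le_antisym; [assumption|].
        now replace (0 + 1) with 1 by ring.
    + intros j [Hj Hj0]; apply lt_iff_succ_le in Hj; now apply succ_le_not_le in Hj.
  - apply lt_iff_succ_le in Hp; replace (1 + 1 * 0) with 1 in Hp by ring.
    exact (not_succ_le _ Hp).
Qed.

Lemma cI1_common_multiple k :
  cI1 Nonzero k -> exists c, 0 < c /\ forall i, 0 < i /\ i <= k -> cdvd i c.
Proof.
  intros [HI0 H]; destruct (H 1) as (c & Hc & Hd & _).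
  { apply pos_iff, le_refl. }
  exists c; split; [assumption|]; intros i [Hi Hik].
  apply pos_iff in Hi.
  destruct (HI0 i 1 (conj Hi Hik)) as [d <-].
  (* I_1 for [v = 1] makes [1 + d] divide [c]. *)
  replace (d + 1) with (1 + d * 1) by ring; apply Hd.
  apply (le_trans (d + 1)); [apply le_succ|assumption].
Qed.

Lemma sequence_extension_holds k w x :
  cI3 Nonzero k ->
  exists w', forall i y, i <= k ->
    (cbeta' y i w' <-> (i < k /\ cbeta' y i w) \/ (i = k /\ y = x)).
Proof.
  intros [[HI1 HI2] HI3].
  assert (exists u v, forall i, i < k -> forall y,
            crem u (1 + (i + 1) * v) y <-> cbeta' y i w) as (u & v & Huv).
  { destruct (HI3 w) as [w1 Hw1].
    destruct (classic (0 < k)) as [Hk|Hk].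
    - destruct (cbeta'_total 0 w) as [y Hy]; apply Hw1 in Hy; [|assumption].
      destruct Hy as (u & v & q & -> & _); exists u, v; intros i Hi z.
      rewrite <- cbeta_cpair; now apply Hw1.
    - exists 0, 0; intros i Hi; exfalso; apply Hk.
      apply lt_iff_succ_le in Hi; apply lt_iff_succ_le.
      apply (le_trans (i + 1)); [apply add_le_r, le_0|assumption]. }
  (* The moduli of [w'] are [1 + i * v'] for [0 < i <= k + 1], index [i - 1]
     of the sequence corresponding to [i]; the case [i = 0] of I_2 concerns
     the modulus 1 and is trivial. *)
  destruct (cI1_common_multiple k HI1) as (c & Hc & Hdvd).
  apply pos_iff in Hc.
  set (v' := c * (v + x)).
  assert (Hv' : v + x <= v').
  { replace (v + x) with (1 * (v + x)) by ring; now apply mul_le_r. }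
  destruct (HI2 u v v' x) as [u' Hu'].
  destruct Hu' as [Hold Hnew].
  { split; [|split; [|split]].
    - intros i Hi; destruct (Hdvd i Hi) as [q Hq]; exists (q * (v + x)).
      unfold v'; rewrite Hq; ring.
    - apply (le_trans (v + x)); [apply le_add|assumption].
    - apply (le_trans v').
      + apply (le_trans (v + x)); [rewrite add_comm; apply le_add|assumption].
      + replace ((k + 1) * v') with (v' + k * v') by ring; apply le_add.
    - intros i Hi; destruct (eq_or_succ_le 0 i) as [<-|[L|L]].
      + exists 0; split; [|exists u; ring].
        apply lt_iff_succ_le; replace (1 + 0 * v) with (0 + 1) by ring; apply le_refl.
      + destruct HI1 as [HI0 _]; apply lt_iff_succ_le, pos_iff in L.
        destruct (HI0 i 1 (conj L Hi)) as [d <-].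
        destruct (cbeta'_total d w) as [r Hr]; exists r; apply Huv; [|assumption].
        apply lt_iff_succ_le; assumption.
      + exfalso; apply (succ_le_not_le _ _ L), le_0. }
  assert (Hrem : forall i, i < k -> forall y,
            crem u' (1 + (i + 1) * v') y <-> cbeta' y i w).
  { intros i Hi y; destruct (Hold (i + 1)) as (r & Hr & Hr').
    - apply -> lt_iff_succ_le; assumption.
    - rewrite <- Huv by assumption; split; intros Hy;
        [rewrite (crem_unique _ _ _ _ Hy Hr')|rewrite (crem_unique _ _ _ _ Hy Hr)];
        assumption. }
  exists (cpair u' v'); intros i y Hi.
  assert (Hall : forall j, j <= i -> exists z, cbeta z j (cpair u' v')).
  { intros j Hj.
    assert (Hjk : j <= k) by (now apply (le_trans i)).
    apply le_iff_lt_or_eq in Hjk as [Hjk| ->].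
    - destruct (cbeta'_total j w) as [z Hz]; exists z; apply cbeta_cpair.
      now apply Hrem.
    - exists x; now apply cbeta_cpair. }
  rewrite cbeta'_cbeta, cbeta_cpair by assumption.
  apply le_iff_lt_or_eq in Hi as [Hi| ->].
  - rewrite Hrem by assumption; destruct Hi as [? Hne]; split; [|tauto].
    intros Hy; left; split; [split|]; assumption.
  - split.
    + intros Hy; right; split; [reflexivity|exact (crem_unique _ _ _ _ Hy Hnew)].
    + intros [[[_ Hk] _]|[_ ->]]; [now destruct Hk|assumption].
Qed.

Section Cut.
Context (N : form) (N_unary : bounded 1 N).
Context (N_0 : defset N 0) (N_succ : forall x, defset N x -> defset N (x + 1)).
Context (N_down : forall x y, defset N y /\ x <= y -> defset N x).
Context (N_add : forall x y, defset N x /\ defset N y -> defset N (x + y)).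
Context (N_mul : forall x y, defset N x /\ defset N y -> defset N (x * y)).
Context (N_I0 : forall x, defset N x -> cI0 x).

Lemma closed_domain_holds (A : fm) e : In A (closed_domain N) -> sat M e (A O).
Proof.
  cbn [In closed_domain]; intros [<-|[<-|[<-|[<-|[]]]]].
  - refine (proj2 (_ : means M e _ _) N_0); read.
  - refine (proj2 (_ : means M e _ _) N_succ); read.
  - refine (proj2 (_ : means M e _ _) N_add); read.
  - refine (proj2 (_ : means M e _ _) N_mul); read.
Qed.

Lemma relativized_Q_holds (A : fm) e :
  In A Q_axioms -> sat M e (relativize N (A O)).
Proof.
  cbn [In Q_axioms]; intros [<-|[<-|[<-|[<-|[<-|[<-|[<-|[<-|[]]]]]]]]].
  - refine (proj2 (_ : means M e _ (forall x, defset N x -> ~ x + 1 = 0)) _); [read|].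
    intros x _ E; apply (succ_le_not_le x 0); [rewrite E; apply le_refl|apply le_0].
  - refine (proj2 (_ : means M e _ (forall x, defset N x -> forall y, defset N y ->
      x + 1 = y + 1 -> x = y)) _); [read|].
    intros x _ y _; apply add_cancel.
  - refine (proj2 (_ : means M e _ (forall x, defset N x -> ~ x = 0 ->
      exists y, defset N y /\ x = y + 1)) _); [read|].
    intros x Nx Hx.
    assert (L : 1 <= x).
    { destruct (eq_or_succ_le 0 x) as [E|[L|L]].
      - now symmetry in E.
      - apply pos_iff, lt_iff_succ_le; assumption.
      - exfalso; apply (succ_le_not_le _ _ L), le_0. }
    destruct (N_I0 x Nx x 1 (conj L (le_refl x))) as [d <-].
    exists d; split; [|reflexivity].
    apply (N_down d (d + 1)); split; [assumption|apply le_succ].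
  - refine (proj2 (_ : means M e _ (forall x, defset N x -> x + 0 = x)) _); [read|].
    intros; ring.
  - refine (proj2 (_ : means M e _ (forall x, defset N x -> forall y, defset N y ->
      x + (y + 1) = (x + y) + 1)) _); [read|].
    intros; ring.
  - refine (proj2 (_ : means M e _ (forall x, defset N x -> x * 0 = 0)) _); [read|].
    intros; ring.
  - refine (proj2 (_ : means M e _ (forall x, defset N x -> forall y, defset N y ->
      x * (y + 1) = x * y + x)) _); [read|].
    intros; ring.
  - refine (proj2 (_ : means M e _ (forall x, defset N x -> forall y, defset N y ->
      (x <= y <-> exists z, defset N z /\ z + x = y))) _); [read|].
    intros x _ y Ny; split.
    + intros L; destruct (N_I0 y Ny y x (conj L (le_refl y))) as [d <-].
      exists d; split; [|reflexivity].
      apply (N_down d (d + x)); split; [assumption|apply le_add].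
    + intros (z & _ & <-); rewrite add_comm; apply le_add.
Qed.

End Cut.

Lemma means_beta' e (t1 t2 t3 : term) x i w :
  eval M e t1 = x -> eval M e t2 = i -> eval M e t3 = w ->
  means M e (subst (scons t1 (scons t2 (scons t3 Var))) beta'_form) (cbeta' x i w).
Proof.
  intros <- <- <-; apply means_subst; unfold beta'_form, free; read.
Qed.

Lemma sequence_extension_sat N e :
  bounded 1 N -> (forall x, defset N x -> cI3 Nonzero x) ->
  sat M e (sequence_extension N beta'_form O).
Proof.
  intros HN HI3.
  refine (proj2 (_ : means M e _ (forall w x k, exists w', forall i y,
    defset N k /\ i <= k ->
    (cbeta' y i w' <-> (i < k /\ cbeta' y i w) \/ (i = k /\ y = x)))) _).
  - expand_macros.
    repeat first [apply means_beta'; reflexivity | progress read].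
  - intros w x k; destruct (classic (defset N k)) as [Nk|Nk].
    + destruct (sequence_extension_holds k w x (HI3 k Nk)) as [w' Hw'].
      exists w'; intros i y [_ Hi]; auto.
    + exists 0; intros i y [Nk' _]; now destruct Nk.
Qed.

End Model.

Lemma PAminus_closed : closed_theory PAminus.
Proof.
  intros A (B & HB & ->); unfold PAminus_axioms in HB; cbn [In] in HB.
  repeat destruct HB as [<-|HB]; try destruct HB; cbn; repeat split; lia.
Qed.

Lemma means_cut (M : structure) e N :
  bounded 1 N ->
  means M e ((cut N /\ closed_add_mul N)%fo 0%nat)
    (((defset N (czero M) /\ (forall x, defset N x -> defset N (cadd M x (cone M)))) /\
      (forall x y, defset N y /\ cle M x y -> defset N x)) /\
     (forall x y, defset N x /\ defset N y -> defset N (cadd M x y)) /\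
     (forall x y, defset N x /\ defset N y -> defset N (cmul M x y))).
Proof. intros HN; read. Qed.

Lemma means_I3 (M : structure) e N rd :
  bounded 1 N ->
  means M e ((FA x, app1 N x --> I3 rd x)%fo 0%nat) (forall x, defset N x -> cI3 M rd x).
Proof. intros HN; destruct rd; read. Qed.

Theorem theorem11 (rd : reading) (N : form)
    (N_unary : bounded 1 N)
    (N_cut : provable PAminus ((cut N /\ closed_add_mul N)%fo 0%nat))
    (N_I3 : provable PAminus ((FA x, app1 N x --> I3 rd x)%fo 0%nat)) :
  sequential PAminus N beta'_form.
Proof.
  assert (HN : forall M : structure, models M PAminus ->
    (((defset N (czero M) /\ (forall x, defset N x -> defset N (cadd M x (cone M)))) /\
      (forall x y, defset N y /\ cle M x y -> defset N x)) /\
     (forall x y, defset N x /\ defset N y -> defset N (cadd M x y)) /\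
     (forall x y, defset N x /\ defset N y -> defset N (cmul M x y))) /\
    forall x, defset N x -> cI3 M Nonzero x).
  { intros M HM; set (e := fun _ : nat => czero M).
    pose proof (proj1 (means_cut M e N N_unary) (soundness _ _ M e HM N_cut)) as Hcut.
    pose proof (proj1 (means_I3 M e N rd N_unary) (soundness _ _ M e HM N_I3)) as HI3.
    split; [exact Hcut|].
    destruct rd; [|exact HI3].
    destruct (cI1_0_verbatim_absurd M HM); apply HI3, Hcut. }
  split; [assumption|split; [|split; [split|]]].
  - cbn; repeat split; lia.
  - intros A HA; apply completeness; [exact PAminus_closed|]; intros M e HM.
    destruct (HN M HM) as [[[[? ?] ?] [? ?]] _].
    eapply closed_domain_holds; eauto.
  - intros A HA; apply completeness; [exact PAminus_closed|]; intros M e HM.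
    destruct (HN M HM) as [[[[? ?] ?] [? ?]] HI3].
    apply relativized_Q_holds; auto.
    intros x Hx; destruct (HI3 x Hx) as [[[HI0 _] _] _]; exact HI0.
  - apply completeness; [exact PAminus_closed|]; intros M e HM.
    apply sequence_extension_sat; auto; now apply HN.
Qed.
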